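(* For each special braid $b$, the $\mathcal{G}^{sp}_\infty$-sequence from $b$ is finite, i.e., there exists a natural number $t$ satisfying $b\{1\}^{sp}\{2\}^{sp}\cdots\{t\}^{sp}=1$.
   Context: For $n\ge2$, $B_n^+$ is the monoid of positive $n$-strand braids, with generators $\sigma_1,\dots,\sigma_{n-1}$ and relations $\sigma_i\sigma_j=\sigma_j\sigma_i$ for $|i-j|\ge2$, $\sigma_i\sigma_j\sigma_i=\sigma_j\sigma_i\sigma_j$ for $|i-j|=1$; $B_n^+$ is identified with a submonoid of $B_{n+1}^+$. The flip automorphism $\phi_n$ of $B_n^+$ maps $\sigma_i$ to $\sigma_{n-i}$. Skew product. For $n\ge3$ and $b\in B_{n-1}^+$ (viewed in $B_n^+$), put $\widetilde\phi_n b=\sigma_1\sigma_2^2\cdots\sigma_{n-2}^2\sigma_{n-1}\cdot\phi_n(b)\cdot\sigma_{n-1}\sigma_{n-2}^2\cdots\sigma_2^2\sigma_1$. For $b_p,\dots,b_1\in B_{n-1}^+$, the skew product $\langle b_p,\dots,b_1\rangle_{n,p}$ is $\widetilde\phi_n b_p\cdot b_{p-1}\cdots\widetilde\phi_n b_2\cdot b_1$ if $p$ is even and $b_p\cdot\widetilde\phi_n b_{p-1}\cdot b_{p-2}\cdots\widetilde\phi_n b_2\cdot b_1$ if $p$ is odd (entries of even index are replaced by their images under $\widetilde\phi_n$). Special braids. A $2$-special braid is any element $\sigma_1^e$, $e\ge0$, of $B_2^+$. For $n\ge3$, an $n$-special braid is either $1$ or a braid $\langle b_p,\dots,b_1\rangle_{n,p}$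 with $p\ge1$, $b_p,\dots,b_1$ $(n-1)$-special and $b_p\ne1$; this decomposition is unique. Every $(n-1)$-special braid is $n$-special, and a special braid is a braid that is $n$-special for some $n$. Operation. For $t\ge1$ put $\theta_{2,t}=\sigma_1^t$ and, for $n\ge3$, $\theta_{n,t}=\langle\sigma_1,1,\dots,1\rangle_{n,t}$ ($t$ entries). For $b\neq1$ an $n$-special braid and $t\ge1$, $b\{t\}^{sp}_n$ is defined inductively: for $n=2$ it is obtained from $b$ by removing one letter $\sigma_1$. For $n\ge3$, write $b=\langle b_p,\dots,b_r,1,\dots,1\rangle_{n,p}$ with $b_r\ne1$ the rightmost nontrivial entry ($r$ its index), and put $b'_r=b_r\{t\}^{sp}_{n-1}$; then $b\{t\}^{sp}_n$ is - $\langle b_p,\dots,b_{r+1},b'_r,1,\dots,1\rangle_{n,p}$ if $r=1$ or $b_r\ne b'_r\sigma_1$; - $\langle b_p,\dots,b_{r+1},b'_r,\theta_{n-1,t},1,\dots,1\rangle_{n,p}$ if $r\ge2$, $b_r=b'_r\sigma_1$, and ($b'_r\ne1$ or $p>r$); - $\langle\theta_{n-1,t},1,\dots,1\rangle_{n,p-1}$ if $p=r\ge2$ and $b_r=\sigma_1$. If $b$ is $(n-1)$-special then $b\{t\}^{sp}_n=b\{t\}^{sp}_{n-1}$, so one writes $b\{t\}^{sp}$. The $\mathcal{G}^{sp}_\infty$-sequence from $b$ is $(b_0,b_1,\dots)$ with $b_0=b$ and $b_t=b_{t-1}\{t\}^{sp}$ for $t\geq 1$; it stops when $1$ is obtained.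 *)

(* Defs.v *)
From HB Require Import structures.
From mathcomp Require Import all_boot.
From mathcomp Require Import zify.
From mathcomp Require Import boolp classical_sets.

Set Implicit Arguments.
Unset Strict Implicit.
Unset Printing Implicit Defensive.

Local Open Scope quotient_scope.
Local Open Scope group_scope.

(* Positive braid words on [n] strands; the letter [i : 'I_n.-1] is the
   generator sigma_(i+1). *)
Definition word n := seq 'I_n.-1.

(* The congruence generated by the braid relations. *)
Inductive braid_rel n : word n -> word n -> Prop :=
| braid_far (i j : 'I_n.-1) : (i.+1 < j) || (j.+1 < i) ->
    braid_rel [:: i; j] [:: j; i]
| braid_near (i j : 'I_n.-1) : (j == i.+1 :> nat) || (i == j.+1 :> nat) ->
    braid_rel [:: i; j; i] [:: j; i; j]
| braid_refl u : braid_rel u u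
| braid_sym u v : braid_rel u v -> braid_rel v u
| braid_trans u v w : braid_rel u v -> braid_rel v w -> braid_rel u w
| braid_cat u u' v v' : braid_rel u u' -> braid_rel v v' ->
    braid_rel (u ++ v) (u' ++ v').

Definition braid_eqb n (u v : word n) : bool := `[< braid_rel u v >].

Lemma braid_eqb_refl n : reflexive (@braid_eqb n).
Proof. by move=> u; apply/asboolP/braid_refl. Qed.

Lemma braid_eqb_sym n : symmetric (@braid_eqb n).
Proof.
by move=> u v; apply/asboolP/asboolP => /braid_sym.
Qed.

Lemma braid_eqb_trans n : transitive (@braid_eqb n).
Proof.
move=> v u w /asboolP uv /asboolP vw; apply/asboolP; exact: braid_trans uv vw.
Qed.

Canonical braid_equiv n :=
  EquivRel (@braid_eqb n) (@braid_eqb_refl n) (@braid_eqb_sym n)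
    (@braid_eqb_trans n).

Definition braid n := {eq_quot @braid_equiv n}.

HB.instance Definition _ n := Choice.on (braid n).
HB.instance Definition _ n := EqQuotient.on (braid n).

Lemma braid_piP n (u v : word n) :
  \pi_(braid n) u = \pi_(braid n) v <-> braid_rel u v.
Proof.
by split=> [/eqmodP/asboolP | uv]; last by apply/eqmodP/asboolP.
Qed.

Lemma braid_reprP n (u : word n) : braid_rel (repr (\pi_(braid n) u)) u.
Proof. by apply/braid_piP; rewrite reprK. Qed.

Definition braid_one n : braid n := \pi_(braid n) [::].
Definition braid_mul n (a b : braid n) : braid n := \pi_(braid n) (repr a ++ repr b).

Lemma braid_mul_pi n (u v : word n) :
  braid_mul (\pi u) (\pi v) = \pi_(braid n) (u ++ v).
Proof. by apply/braid_piP/braid_cat; apply: braid_reprP. Qed.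

Lemma braid_mulA n : associative (@braid_mul n).
Proof.
elim/quotW=> u; elim/quotW=> v; elim/quotW=> w.
by rewrite !braid_mul_pi catA.
Qed.

Lemma braid_mul1b n : left_id (braid_one n) (@braid_mul n).
Proof. by elim/quotW=> u; rewrite braid_mul_pi. Qed.

Lemma braid_mulb1 n : right_id (braid_one n) (@braid_mul n).
Proof. by elim/quotW=> u; rewrite braid_mul_pi cats0. Qed.

HB.instance Definition _ n := isMonoid.Build (braid n)
  (@braid_mulA n) (@braid_mul1b n) (@braid_mulb1 n).

(* The generator sigma_i of [braid n], for 1 <= i < n. *)
Definition sigma n (i : nat) : braid n := \pi_(braid n) (pmap insub [:: i.-1]).

(* The inclusion of B_n^+ in B_(n+1)^+, sending sigma_i to sigma_i. *)
Definition incl n (b : braid n) : braid n.+1 :=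
  \pi_(braid n.+1) (map (widen_ord (leq_pred n)) (repr b)).

(* On 'I_n.-1, [rev_ord] is i |-> n - 2 - i, hence sigma_i |-> sigma_(n-i). *)
Definition flip n (b : braid n) : braid n :=
  \pi_(braid n) (map (@rev_ord _) (repr b)).

Lemma braid_rel_map m n (f : 'I_m.-1 -> 'I_n.-1) (u v : word m) :
    (forall i j : 'I_m.-1, (i.+1 < j) || (j.+1 < i) ->
       ((f i).+1 < f j) || ((f j).+1 < f i)) ->
    (forall i j : 'I_m.-1, (j == i.+1 :> nat) || (i == j.+1 :> nat) ->
       (f j == (f i).+1 :> nat) || (f i == (f j).+1 :> nat)) ->
  braid_rel u v -> braid_rel (map f u : word n) (map f v).
Proof.
move=> far near; elim=> {u v} /=.
- by move=> i j ij; apply/braid_far/far.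
- by move=> i j ij; apply/braid_near/near.
- by move=> u; apply: braid_refl.
- by move=> u v _; apply: braid_sym.
- by move=> u v w _ uv _; apply: braid_trans.
- by move=> u u' v v' _ uu' _ vv'; rewrite !map_cat; apply: braid_cat.
Qed.

Lemma incl_pi n (u : word n) :
  incl (\pi u) = \pi_(braid n.+1) (map (widen_ord (leq_pred n)) u).
Proof.
by apply/braid_piP/(@braid_rel_map n n.+1) => //; apply: braid_reprP.
Qed.

Lemma flip_pi n (u : word n) :
  flip (\pi u) = \pi_(braid n) (map (@rev_ord _) u).
Proof.
apply/braid_piP/(@braid_rel_map n n); last exact: braid_reprP.
- by move=> i j /=; have := ltn_ord i; have := ltn_ord j; lia.
- by move=> i j /=; have := ltn_ord i; have := ltn_ord j; lia.
Qed.

(* The map phi-tilde_N with N = n.+1, from B_n^+ to B_N^+. *)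
Definition skew_flip n (b : braid n) : braid n.+1 :=
  let N := n.+1 in
  (sigma N 1 * (\prod_(2 <= i < N.-1) sigma N i ^+ 2) * sigma N N.-1)
  * flip (incl b)
  * (sigma N N.-1 * (\prod_(2 <= i < N.-1) sigma N (N - i) ^+ 2) * sigma N 1).

(* The skew product <b_p, ..., b_1> of the list [:: b_p; ...; b_1]: the head of
   a list of size p has index p. *)
Fixpoint skew n (s : seq (braid n)) : braid n.+1 :=
  if s is b :: s' then
    (if odd (size s) then incl b else skew_flip b) * skew s'
  else 1.

Fixpoint special (n : nat) : braid n -> Prop :=
  if n is n'.+1 then
    match n' with
    | 0 => fun=> False
    | 1 => fun b => exists e : nat, b = sigma n'.+1 1 ^+ e
    | _ => fun b => b = 1 \/
        exists (b_p : braid n') (s : seq (braid n')),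
          [/\ b_p != 1,
              (forall c, c \in b_p :: s -> special c)
            & b = skew (b_p :: s)]
    end
  else fun=> False.

Definition theta (n t : nat) : braid n :=
  if n is n'.+1 then
    match n' with
    | 0 => 1
    | 1 => sigma n'.+1 1 ^+ t
    | _ => skew (sigma n' 1 :: nseq t.-1 1)
    end
  else 1.

(* [d = (u, c, k)] stands for the decomposition
   b = <b_p, ..., b_(r+1), b_r, 1, ..., 1> with u = [:: b_p; ...; b_(r+1)],
   c = b_r and k = r - 1 trailing ones; thus p = r iff u = [::]. *)
Definition is_decomposition n (b : braid n.+1)
    (d : seq (braid n) * braid n * nat) : Prop :=
  let: (u, c, k) := d in
  [/\ forall x, x \in u ++ c :: nseq k 1 -> special x,
      head c u != 1, c != 1 & b = skew (u ++ c :: nseq k 1)].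

Definition decomposition n (b : braid n.+1) : seq (braid n) * braid n * nat :=
  xget ([::], 1, 0) [set d | is_decomposition b d].

(* The braid b{t}^sp_n; the value at braids that are not n-special, and at 1,
   is irrelevant. *)
Fixpoint sp_op (n t : nat) : braid n -> braid n :=
  if n is n'.+1 then
    match n' with
    | 0 => id
    | 1 => fun b => xget 1 [set c | b = c * sigma n'.+1 1]
    | _ => fun b =>
        let: (u, c, k) := decomposition b in
        let c' := sp_op t c in
        if (k == 0) || (c != c' * sigma n' 1) then
          skew (u ++ c' :: nseq k 1)
        else if (c' != 1) || (u != [::]) then
          skew (u ++ c' :: theta n' t :: nseq k.-1 1)
        else (* here p = r >= 2 and b_r = sigma_1 *)
          skew (theta n' t :: nseq k.-1 1)
    end
  else id.

(* For b an n-special braid, b{t}^sp is b{t}^sp_n. *)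
Fixpoint G_seq n (b : braid n) (t : nat) : braid n :=
  if t is t'.+1 then sp_op t (G_seq b t') else b.

(* Main.v *)
Require Import Defs.
From mathcomp Require Import all_boot.
From mathcomp Require Import zify boolp classical_sets.
From Stdlib Require Import Inverse_Image Wf_nat.

Set Implicit Arguments.
Unset Strict Implicit.
Unset Printing Implicit Defensive.

Local Open Scope quotient_scope.
Local Open Scope group_scope.

(** Each step of the sequence lowers a special braid in a well-founded order.
For [n = 2] braids are compared by their length. For [n >= 3] they are compared
by the lists of their entries [b_p, ..., b_1], first by the number [p] of
entries and then lexicographically from [b_p] on, the entries being compared in
the order of the previous level ([special_lt_wf]). The three clauses that define
[b{t}] either replace [b_r] by the smaller [b_r{t}], changing only entries to
its right, or remove an entry; in all cases the list decreases ([sp_op_step]).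

This order can be followed along the sequence because the entries are determined
by the braid ([skew_inj]): the list read in [b{t}] at the next step is the one
that was written. The reason is that special braids have a single positive word.
In the word that their definition produces, neighbouring letters have indices
that differ by at most 1, and a letter between two equal letters is equal to
them ([special_loop0]), since wherever two building blocks meet, the letter at
the junction is doubled. No braid relation applies to such a rigid word, so that
it is alone in its class ([braid_rel_rigid]). Uniqueness of the entries thus
becomes a parsing question on words, which is answered from the right: the last
occurrence of the top letter, and the last occurrence of the bottom letter
before it, bound the last two entries ([weave_inj]).

One more fact is needed for the new list to have a nontrivial first entry: if
[b{t} = 1], then [b] is the generator sigma_1. It is part of the induction in
[sp_op_step]. *)

(** * Rigid words *)

Definition near_letters (i j : nat) := (i <= j.+1) && (j <= i.+1).

Definition rigid_head (i : nat) (w : seq nat) : bool :=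
  match w with
  | [::] => true
  | [:: j] => near_letters i j
  | [:: j, k & _] => near_letters i j && ((k == i) ==> (i == j))
  end.

Fixpoint rigid (w : seq nat) : bool :=
  if w is i :: w' then rigid_head i w' && rigid w' else true.

Lemma rigid_catl u v : rigid (u ++ v) -> rigid u.
Proof.
elim: u => [|i u IH] //= /andP[iw /IH ->]; rewrite andbT.
by case: u iw {IH} => [|j [|k u]] //=; case: v => //= k v /andP[].
Qed.

Lemma rigid_catr u v : rigid (u ++ v) -> rigid v.
Proof. by elim: u => [|i u IH] //= /andP[_ /IH]. Qed.

(** Doubling the junction letter protects it: a factor [i j i] of the glued word
with [i <> j] cannot meet both copies of [a], so it lies on one side. *)
Lemma rigid_glue u a v :
  rigid (rcons u a) -> rigid (a :: v) -> rigid (u ++ [:: a, a & v]).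
Proof.
move=> ua av; elim: u ua => [_|i u IH /=].
  move: av => /= ->; rewrite andbT /near_letters.
  by case: v => [|k v] /=; rewrite leqnSn ?eqxx ?implybT.
case/andP=> iu /IH ->; rewrite andbT.
case: u iu {IH} => [|j [|k u]] //=.
by move=> ->; apply/implyP => /eqP ->.
Qed.

(** Neither side of a braid relation is rigid, and factors of rigid words are
rigid, so that no relation can be applied inside a rigid word. *)
Lemma braid_rel_rigid n (u v : word n) :
  braid_rel u v -> rigid (map val u) || rigid (map val v) -> u = v.
Proof.
elim=> {u v} //=.
- by move=> i j; rewrite /near_letters; lia.
- by move=> i j; rewrite /near_letters; lia.
- by move=> u v _ IH uv; rewrite IH // orbC.
- move=> u v w _ IHu _ IHv /orP[ru|rw].
    have uv : u = v by apply: IHu; rewrite ru.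
    by rewrite uv; apply: IHv; rewrite -uv ru.
  have vw : v = w by apply: IHv; rewrite rw orbT.
  by rewrite -vw; apply: IHu; rewrite vw rw orbT.
- move=> u u' v v' _ IHu _ IHv; rewrite !map_cat => /orP[] r;
    have ru := rigid_catl r; have rv := rigid_catr r;
    by rewrite IHu ?ru ?orbT // IHv ?rv ?orbT.
Qed.

(** * Words of braids *)

(** Words are handled as lists of natural numbers, which makes letters comparable
across the inclusions of [braid n] in [braid n.+1]. *)
Definition presents n (b : braid n) (w : seq nat) :=
  exists2 u : word n, b = \pi u & map val u = w.

Definition code n (b : braid n) : seq nat := map val (repr b).

Lemma presents_code n (b : braid n) : presents b (code b).
Proof. by exists (repr b); rewrite ?reprK. Qed.

Lemma presents_inj n (a b : braid n) w : presents a w -> presents b w -> a = b.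
Proof. by case=> u -> <- [v -> /(inj_map val_inj) ->]. Qed.

Lemma code_inj n : injective (@code n).
Proof.
move=> a b ab; apply: presents_inj (presents_code b).
by rewrite -ab; apply: presents_code.
Qed.

Lemma presents_rigid n (b : braid n) w w' :
  presents b w -> presents b w' -> rigid w -> w = w'.
Proof.
case=> u -> <- [v /braid_piP uv <-] ru; congr map.
by apply: braid_rel_rigid uv _; rewrite ru.
Qed.

Lemma code_presents n (b : braid n) w : presents b w -> rigid w -> code b = w.
Proof. by move=> bw /(presents_rigid bw (presents_code b)). Qed.

Lemma presents1 n : presents (1 : braid n) [::].
Proof. by exists [::]. Qed.

Lemma presentsM n (a b : braid n) u v :
  presents a u -> presents b v -> presents (a * b) (u ++ v).
Proof.
case=> x -> <- [y -> <-]; exists (x ++ y); last by rewrite map_cat.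
exact: braid_mul_pi.
Qed.

Lemma presents_sigma n i : i < n.-1 -> presents (sigma n i.+1) [:: i].
Proof.
by move=> lt_in; exists [:: Ordinal lt_in] => //; rewrite /sigma /= insubT.
Qed.

Lemma presentsX n (i e : nat) : i < n.-1 -> presents (sigma n i.+1 ^+ e) (nseq e i).
Proof.
move=> lt_in; elim: e => [|e IH]; first exact: presents1.
rewrite expgS; apply: (presentsM (presents_sigma lt_in) IH).
Qed.

Lemma presents_incl n (b : braid n) w : presents b w -> presents (incl b) w.
Proof.
case=> u -> <-; rewrite incl_pi; eexists; first by [].
by rewrite -map_comp.
Qed.

Lemma presents_flip n (b : braid n) w :
  presents b w -> presents (flip b) (map (subn n.-2) w).
Proof.
case=> u -> <-; rewrite flip_pi; eexists; first by [].
rewrite -!map_comp; apply: eq_map => i /=; have := ltn_ord i; lia.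
Qed.

(** The word [f 0, f 1, f 1, f 2, f 2, ..., f m], with inner letters doubled.
With [f i = i] and [f i = m - i] it gives the two outer factors of a flipped
entry; writing it as a sequence of pairs shows that it is made by gluing. *)
Fixpoint climb (f : nat -> nat) (m : nat) : seq nat :=
  if m is m'.+1 then climb f m' ++ [:: f m'; f m] else [::].

Lemma presents_climb n f m : 0 < m -> (forall i, i <= m -> f i < n.-1) ->
  presents (sigma n (f 0).+1 * (\prod_(2 <= i < m.+1) sigma n (f i.-1).+1 ^+ 2)
            * sigma n (f m).+1) (climb f m).
Proof.
elim: m => [|[|m] IH] // _ fn.
  rewrite big_geq // mulg1.
  by apply: (presentsM (u := [:: f 0])); apply: presents_sigma; apply: fn.
rewrite big_nat_recr //=; set a := sigma _ _; set p := \prod_(_ <= _ < _) _.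
set x := sigma _ (f m.+1).+1; set y := sigma _ _.
have -> : a * (p * x ^+ 2) * y = (a * p * x) * (x * y).
  by rewrite expgS expg1 !mulgA.
apply: presentsM; first by apply: IH => // i im; apply: fn; apply: leqW.
by apply: (presentsM (u := [:: f m.+1])); apply: presents_sigma; apply: fn.
Qed.

Lemma presents_skew_flip n (b : braid n) w : 1 < n -> presents b w ->
  presents (skew_flip b) (climb id n.-1 ++ map (subn n.-1) w ++ climb (subn n.-1) n.-1).
Proof.
case: n b => [|[|m]] // b _ bw; rewrite /skew_flip catA.
apply: presentsM; first apply: presentsM.
- have := @presents_climb m.+3 id m.+1 isT.
  rewrite (@eq_big_nat _ _ _ _ _ _ (fun i => sigma m.+3 i ^+ 2)); first by apply.
  by move=> i /andP[i2 _]; rewrite prednK // ltnW.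
- exact: presents_flip (presents_incl bw).
- have := @presents_climb m.+3 (subn m.+1) m.+1 isT.
  rewrite (@eq_big_nat _ _ _ _ _ _ (fun i => sigma m.+3 (m.+3 - i) ^+ 2)).
    by rewrite subnn subn0; apply => i _; rewrite /= ltnS leq_subr.
  by move=> i i2; congr (sigma _ _ ^+ _); lia.
Qed.

Definition block (m : nat) (flipped : bool) (w : seq nat) : seq nat :=
  if flipped then climb id m ++ map (subn m) w ++ climb (subn m) m else w.

(** The head of the list is the rightmost block. In this order the alternation of
plain and flipped blocks starts from a fixed end, independently of the number
of entries. *)
Fixpoint weave (m : nat) (flipped : bool) (ws : seq (seq nat)) : seq nat :=
  if ws is w :: ws' then weave m (~~ flipped) ws' ++ block m flipped w else [::].

Lemma weave_rcons m fl ws w :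
  weave m fl (rcons ws w) = block m (fl (+) odd (size ws)) w ++ weave m fl ws.
Proof.
elim: ws fl => [|w' ws IH] fl /=; first by rewrite cats0 addbF.
by rewrite IH -catA addNb addbN.
Qed.

Lemma presents_skew n (s : seq (braid n)) : 1 < n ->
  presents (skew s) (weave n.-1 false (rev (map (@code n) s))).
Proof.
move=> n1; elim: s => [|b s IH]; first exact: presents1.
rewrite [map _ _]/= rev_cons weave_rcons size_rev size_map.
apply: presentsM IH; rewrite /=; case: (odd _) => /=.
  exact: presents_skew_flip (presents_code b).
exact: presents_incl (presents_code b).
Qed.

(** * The words of special braids are rigid *)

(** A chain from [i] to [j] is made of pieces of length at most 2, each one
starting with the letter that ends the previous one. *)
Inductive chain : nat -> nat -> seq nat -> Prop :=
| chain1 i : chain i i [:: i]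
| chain2 i j : near_letters i j -> chain i j [:: i; j]
| chain_cat i j k u v : chain i j u -> chain j k v -> chain i k (u ++ v).

Lemma chain_rigid i j w : chain i j w ->
  [/\ rigid w, exists u, w = i :: u & exists u, w = rcons u j].
Proof.
elim=> {i j w} [i|i j ij|i j k u' v' _ [ru [u Eu] [u1 Eu1]] _ [rv [v Ev] [v1 Ev1]]].
- by split=> //; [exists [::] | exists [::]].
- by rewrite /= ij; split=> //; [exists [:: j] | exists [:: i]].
- split; last by exists (u' ++ v1); rewrite Ev1 rcons_cat.
    by rewrite Eu1 Ev cat_rcons; apply: rigid_glue; rewrite -?Eu1 -?Ev.
  by exists (u ++ v'); rewrite Eu.
Qed.

Lemma chain_map (f : nat -> nat) i j w :
    (forall x y, near_letters x y -> near_letters (f x) (f y)) ->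
  chain i j w -> chain (f i) (f j) (map f w).
Proof.
move=> fP; elim=> {i j w} /=.
- by move=> i; apply: chain1.
- by move=> i j ij; apply: chain2; apply: fP.
- by move=> i j k u v _ cu _ cv; rewrite map_cat; apply: chain_cat cu cv.
Qed.

Lemma chain_climb f m : 0 < m ->
  (forall i, i < m -> near_letters (f i) (f i.+1)) -> chain (f 0) (f m) (climb f m).
Proof.
elim: m => [|[|m] IH] // _ fP; first by apply: chain2; apply: fP.
apply: (@chain_cat _ (f m.+1)); last by apply: chain2; apply: fP.
by apply: IH => // i im; apply: fP; apply: leqW.
Qed.

Definition loop0 (w : seq nat) := w = [::] \/ chain 0 0 w.

Lemma loop0_cat u v : loop0 u -> loop0 v -> loop0 (u ++ v).
Proof.
case=> [-> // | cu] [-> | cv]; first by rewrite cats0; right.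
by right; apply: chain_cat cu cv.
Qed.

Lemma loop0_rigid w : loop0 w -> rigid w.
Proof. by case=> [-> // | /chain_rigid[]]. Qed.

(** The flip sends loops at [0] to loops at [m], and the two climbs lead from [0]
to [m] and back. *)
Lemma loop0_block m fl w : 0 < m -> loop0 w -> loop0 (block m fl w).
Proof.
case: fl => // m0 lw; right; rewrite /= catA -{2}(subnn m).
have subnP x y : near_letters x y -> near_letters (m - x) (m - y).
  by rewrite /near_letters; lia.
have up : chain 0 m (climb id m).
  by apply: (@chain_climb id) => // i _; rewrite /near_letters; lia.
have down : chain m (m - m) (climb (subn m) m).
  rewrite -{1}(subn0 m); apply: chain_climb => // i _.
  by rewrite /near_letters; lia.
apply: chain_cat down; case: lw => [-> | cw]; first by rewrite cats0.
by have := chain_map subnP cw; rewrite subn0; apply: chain_cat up.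
Qed.

Lemma loop0_weave m fl ws : 0 < m ->
  (forall w, w \in ws -> loop0 w) -> loop0 (weave m fl ws).
Proof.
move=> m0; elim: ws fl => [|w ws IH] fl wsP /=; first by left.
apply: loop0_cat; last by apply: loop0_block => //; apply: wsP; rewrite mem_head.
by apply: IH => v vws; apply: wsP; rewrite inE vws orbT.
Qed.

(** The lists of entries that the definition of special braids allows. The empty
list stands for the braid [1]. *)
Definition normal n (s : seq (braid n)) : Prop :=
  (forall c, c \in s -> special c) /\ (s = [::] \/ head 1 s != 1).

Lemma specialP n (b : braid n.+1) : 1 < n ->
  special b <-> exists2 s, normal s & b = skew s.
Proof.
case: n b => [|[|n]] // b _; split=> [[-> | [c [s [c1 sP ->]]]] | [[|c s] [sP c1] ->]].
- by exists [::] => //; split=> //; left.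
- by exists (c :: s) => //; split=> //; right.
- by left.
- by right; exists c, s; split=> //; case: c1.
Qed.

Lemma loop0_nseq e : loop0 (nseq e 0).
Proof.
elim: e => [|e IH]; first by left.
by apply: (@loop0_cat [:: 0]) IH; right; apply: chain1.
Qed.

Lemma code_sigma1X e : code (sigma 2 1 ^+ e) = nseq e 0.
Proof. by apply: code_presents (loop0_rigid (loop0_nseq e)); apply: presentsX. Qed.

Lemma special_loop0 n (b : braid n) : special b -> loop0 (code b).
Proof.
elim: n b => [|n IH] b //; case: (ltnP 1 n) => n1; last first.
  case: n n1 b {IH} => [|[|n]] // _ b [e ->]; rewrite code_sigma1X.
  exact: loop0_nseq.
case/specialP=> // s [sP _] ->; have pres := presents_skew s n1.
have lw : loop0 (weave n.-1 false (rev (map (@code n) s))).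
  apply: loop0_weave => [|w]; first by case: n n1 {IH s sP pres b} => [|[]].
  by rewrite mem_rev => /mapP[c /sP sc ->]; apply: IH.
by rewrite (code_presents pres (loop0_rigid lw)).
Qed.

Lemma code_skew n (s : seq (braid n)) : 1 < n -> (forall c, c \in s -> special c) ->
  code (skew s) = weave n.-1 false (rev (map (@code n) s)).
Proof.
move=> n1 sP; apply: (code_presents (presents_skew s n1)).
apply/loop0_rigid/loop0_weave => [|w]; first by case: n n1 {s sP} => [|[]].
by rewrite mem_rev => /mapP[c /sP sc ->]; apply: special_loop0.
Qed.

(** * Uniqueness of the entries *)

Lemma climb_head f m : (forall i, 0 < i -> i <= m.+1 -> f i != f 0) ->
  exists2 t, climb f m.+1 = f 0 :: t & f 0 \notin t.
Proof.
elim: m => [|m IH] fP.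
  by exists [:: f 1%N] => //; rewrite inE eq_sym fP.
have [|t E t0] := IH; first by move=> i i0 im; apply: fP => //; apply: leqW.
exists (t ++ [:: f m.+1; f m.+2]); last first.
  by rewrite mem_cat !inE negb_or t0 negb_or ![f 0 == _]eq_sym !fP.
by rewrite -cat_cons -E.
Qed.

(** Let [m] be the top letter. A flipped block reads
[0 :: (up ++ w') ++ m :: dn], where [up] and the reflected word [w'] avoid [0]
and [dn] avoids [m], while a plain block avoids [m]. So if the rightmost block
[w] is plain and not alone, the last [m] of the word is followed by [dn ++ w];
if it is flipped, [dn] ends the word, and what precedes the last [m] is cut at
its last [0]. The default [[:: 0]] makes the conditions on [last] hold for the
empty list; they exclude empty words at the far left, which would leave no
trace. *)
Lemma weave_inj m fl ws ws' : 0 < m ->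
    (forall w, w \in ws ++ ws' -> all (ltn^~ m) w) ->
    last [:: 0] ws != [::] -> last [:: 0] ws' != [::] ->
  weave m fl ws = weave m fl ws' -> ws = ws'.
Proof.
case: m => // m _.
have [up upE up0] : exists2 t, climb id m.+1 = 0 :: t & 0 \notin t.
  by apply: (@climb_head id) => i; rewrite lt0n.
have [dn dnE dnm] : exists2 t, climb (subn m.+1) m.+1 = m.+1 :: t & m.+1 \notin t.
  have [|t E] := @climb_head (subn m.+1) m; last by rewrite subn0 in E *; exists t.
  by move=> i i0 im; lia.
have flipE w : block m.+1 true w = 0 :: (up ++ map (subn m.+1) w) ++ m.+1 :: dn.
  by rewrite /block upE dnE /= catA.
have flip0 w : all (ltn^~ m.+1) w -> 0 \notin up ++ map (subn m.+1) w.
  move=> wm; rewrite mem_cat negb_or up0; apply/mapP => -[i /(allP wm)].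
  by move=> /=; lia.
have plainm w : all (ltn^~ m.+1) w -> m.+1 \notin dn ++ w.
  move=> wm; rewrite mem_cat negb_or dnm; apply/negP => /(allP wm) /=.
  by rewrite ltnn.
have plain0 w : all (ltn^~ m.+1) w -> m.+1 \notin w.
  by move=> /plainm; rewrite mem_cat negb_or => /andP[].
have weaveE fl' w ws1 :
  weave m.+1 fl' (w :: ws1) = weave m.+1 (~~ fl') ws1 ++ block m.+1 fl' w by [].
have endE w ws1 : exists p, weave m.+1 true (w :: ws1) = p ++ m.+1 :: dn.
  exists (weave m.+1 false ws1 ++ 0 :: up ++ map (subn m.+1) w).
  by rewrite weaveE flipE -[RHS]catA.
elim: ws ws' fl => [|w ws IH] [|w' ws'] fl wsP // lw lw'.
(* A nonempty list has a nonempty word: the word contains the letter [m.+1],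
   unless the list consists of one plain block, which is then nonempty. *)
- case: fl; first by have [p ->] := endE w' ws'; case: p.
  case: ws' wsP lw' => [|v ws'] wsP lw'; first by move=> /= E; rewrite -E in lw'.
  by rewrite weaveE; have [p ->] := endE v ws'; case: p.
- case: fl; first by have [p ->] := endE w ws; case: p.
  case: ws wsP lw {IH} => [|v ws] wsP lw; first by move=> /= E; rewrite E in lw.
  by rewrite weaveE; have [p ->] := endE v ws; case: p.
have wm : all (ltn^~ m.+1) w by apply: wsP; rewrite mem_head.
have wm' : all (ltn^~ m.+1) w' by apply: wsP; rewrite mem_cat mem_head orbT.
have sP : forall v, v \in ws ++ ws' -> all (ltn^~ m.+1) v.
  move=> v; rewrite mem_cat => vP; apply: wsP.
  by rewrite mem_cat !inE; case/orP: vP => ->; rewrite !orbT.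
have lws v vs : last [:: 0] (v :: vs) != [::] -> last [:: 0] vs != [::].
  by case: vs.
have {}IH := IH ws' (~~ fl) sP (lws _ _ lw) (lws _ _ lw').
case: fl IH => IH.
- have joinE p q : p ++ 0 :: q ++ m.+1 :: dn = (p ++ 0 :: q) ++ m.+1 :: dn.
    by rewrite -catA.
  rewrite !weaveE !flipE !joinE => /eqP.
  rewrite eqseq_pivot2r // eqseq_pivot2r ?flip0 // eqseq_cat // !eqxx andbT /=.
  move=> /andP[/eqP/IH <- /eqP E].
  congr cons; have subK v : all (ltn^~ m.+1) v -> map (subn m.+1) (map (subn m.+1) v) = v.
    by move=> /allP vm; rewrite -map_comp map_id_in // => i /vm /= im; lia.
  by rewrite -(subK w wm) E subK.
- rewrite !weaveE /=.
  case: ws ws' IH {wsP lw lw' sP} => [|v ws] [|v' ws'] IH E.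
  + by rewrite -[w]/([::] ++ w) E.
  (* A single plain block lacks the letter [m.+1] that any second block brings. *)
  + have [p Ep] := endE v' ws'; move: (plain0 w wm).
    by rewrite -[w]/(weave m.+1 true [::] ++ w) E Ep !mem_cat mem_head orbT.
  + have [p Ep] := endE v ws; move: (plain0 w' wm').
    by rewrite -[w']/(weave m.+1 true [::] ++ w') -E Ep !mem_cat mem_head orbT.
  + have [p Ep] := endE v ws; have [p' Ep'] := endE v' ws'.
    move: E; rewrite Ep Ep' -!catA !cat_cons.
    move/eqP; rewrite eqseq_pivot2r ?plainm // eqseq_cat // eqxx /=.
    move=> /andP[/eqP pp' /eqP ->].
    by congr cons; apply: IH; rewrite Ep Ep' pp'.
Qed.

Lemma code_lt n (b : braid n) : all (ltn^~ n.-1) (code b).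
Proof. by apply/allP => _ /mapP[i _ ->] /=; apply: ltn_ord. Qed.

Lemma code1 n : code (1 : braid n) = [::].
Proof. by apply: code_presents => //; apply: presents1. Qed.

Lemma skew_inj n (s s' : seq (braid n)) : 1 < n -> normal s -> normal s' ->
  skew s = skew s' -> s = s'.
Proof.
move=> n1 [sP s1] [sP' s1'] /(congr1 (@code _)).
rewrite !code_skew // => /weave_inj E.
apply/(inj_map (@code_inj n))/(inv_inj revK)/E.
- by case: n n1 {s s' sP s1 sP' s1' E} => [|[]].
- by move=> w; rewrite mem_cat !mem_rev => /orP[] /mapP[c _ ->]; apply: code_lt.
- case: s s1 {sP E} => [|c s] [] // c1; rewrite map_cons rev_cons last_rcons.
  by rewrite -(code1 n); apply: contra c1 => /eqP/code_inj ->.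
- case: s' s1' {sP' E} => [|c s'] [] // c1; rewrite map_cons rev_cons last_rcons.
  by rewrite -(code1 n); apply: contra c1 => /eqP/code_inj ->.
Qed.

(** * The order on special braids *)

Fixpoint lexlt T (r : T -> T -> Prop) (s s' : seq T) : Prop :=
  match s, s' with
  | x :: s1, y :: s2 => r x y \/ x = y /\ lexlt r s1 s2
  | _, _ => False
  end.

Definition shortlex T (r : T -> T -> Prop) (s s' : seq T) : Prop :=
  size s < size s' \/ size s = size s' /\ lexlt r s s'.

(** Lexicographic comparison is well founded on lists of a given length, by
induction on this length; the comparison of lengths is put on top. *)
Lemma shortlex_wf T (r : T -> T -> Prop) : well_founded r -> well_founded (shortlex r).
Proof.
move=> rwf; pose sl (s s' : seq T) := size s = size s' /\ lexlt r s s'.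
have slwf s : Acc sl s.
  have [n] := ubnP (size s); elim: n s; first by [].
  move=> n IH [_|x s]; first by constructor=> s [/size0nil ->].
  elim: {x}(rwf x) s => x _ IHx s; rewrite /= ltnS => sn.
  have accs := IH s sn; elim: accs sn => {}s _ IHs sn.
  constructor=> -[|y s'] []; first by [].
  rewrite /= => -[ss'] [yx|[-> ltss']].
  - by apply: (IHx _ yx); rewrite /= ss'.
  - by apply: IHs => //; rewrite ss'.
move=> s; have [n] := ubnP (size s); elim: n s; first by [].
move=> n IH s.
elim: (slwf s) => {}s _ IHs sn; constructor=> s' [ss'|ss'].
  by apply: IH; apply: leq_trans ss' _.
by apply: IHs => //; case: ss' => ->.
Qed.

Lemma shortlex_subst T (r : T -> T -> Prop) u c c' v v' :
  r c' c -> size v' = size v -> shortlex r (u ++ c' :: v') (u ++ c :: v).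
Proof.
move=> cc' vv'; right; split; first by rewrite !size_cat /= vv'.
by elim: u => [|x u IH] /=; [left | right].
Qed.

(** Unlike [decomposition], this reads the whole list, and gives the empty list
for the braid [1]. *)
Definition entries n (b : braid n.+1) : seq (braid n) :=
  xget [::] [set s | normal s /\ b = skew s]%classic.

Lemma entries_skew n (s : seq (braid n)) : 1 < n -> normal s -> entries (skew s) = s.
Proof.
move=> n1 sP; rewrite /entries.
have [sP' E] : [set s' | normal s' /\ skew s = skew s']%classic (entries (skew s)).
  by apply: xgetPex; exists s.
by apply/esym/skew_inj.
Qed.

Fixpoint special_lt n : braid n -> braid n -> Prop :=
  if n is n'.+1 then fun a b =>
    if 1 < n' then shortlex (@special_lt n') (entries a) (entries b)
    else size (code a) < size (code b)
  else fun _ _ => False.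

Lemma special_lt_wf n : well_founded (@special_lt n).
Proof.
elim: n => [|n IH]; first by [].
rewrite /=; case: (1 < n); first exact: wf_inverse_image (shortlex_wf IH).
apply: (well_founded_lt_compat _ (fun b : braid n.+1 => size (code b))).
by move=> a b /ltP.
Qed.

(** * One step of the sequence *)

Lemma special1 n : 1 < n -> special (1 : braid n).
Proof.
case: n => [|[|[|n]]] // _; first by exists 0.
by left.
Qed.

Lemma sigma1_neq1 n : 1 < n -> sigma n 1 != 1.
Proof.
case: n => [|[|n]] // _; apply/eqP => /(congr1 (@code _)).
by rewrite code1 (code_presents (presents_sigma _)).
Qed.

Lemma skew1 n (b : braid n) : skew [:: b] = incl b.
Proof. by rewrite /= mulg1. Qed.

Lemma incl1 n : incl (1 : braid n) = 1.
Proof. exact: presents_inj (presents_incl (presents1 n)) (presents1 _). Qed.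

Lemma incl_sigma1 n : 1 < n -> incl (sigma n 1) = sigma n.+1 1.
Proof.
case: n => [|[|n]] // _.
by apply: (@presents_inj _ _ _ [:: 0]); [apply: presents_incl|]; apply: presents_sigma.
Qed.

Lemma special_sigma1 n : 1 < n -> special (sigma n 1).
Proof.
elim: n => // -[|[_ _|n IH _]] //; first by exists 1%N.
right; exists (sigma n.+2 1), [::]; split; first exact: sigma1_neq1.
  by move=> c; rewrite inE => /eqP ->; apply: IH.
by rewrite skew1 incl_sigma1.
Qed.

Lemma normal_theta n t : 1 < n -> normal (sigma n 1 :: nseq t 1).
Proof.
move=> n1; split; last by right; apply: sigma1_neq1.
move=> c; rewrite inE mem_nseq => /orP[/eqP ->|/andP[_ /eqP ->]].
  exact: special_sigma1.
exact: special1.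
Qed.

Lemma skew_neq1 n (s : seq (braid n)) : 1 < n -> normal s -> s <> [::] -> skew s != 1.
Proof.
move=> n1 sP s0; apply/eqP => E; apply: s0; apply: skew_inj => //.
by split=> //; left.
Qed.

Lemma special_theta n t : 1 < n -> 0 < t -> special (theta n t) /\ theta n t != 1.
Proof.
case: n => [|[|[|n]]] // _ t0.
  split; first by exists t.
  apply/eqP => /(congr1 (@code _)); rewrite code1 code_sigma1X.
  by case: t t0.
have tP : normal (sigma n.+2 1 :: nseq t.-1 1) by apply: normal_theta.
split; last exact: skew_neq1.
by apply/specialP => //; eexists; first exact: tP.
Qed.

(** The rightmost nontrivial entry exists because the first entry is one. *)
Lemma decomposition_spec n (b : braid n.+1) : 1 < n -> special b -> b != 1 ->
  is_decomposition b (decomposition b).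
Proof.
move=> n1 /specialP[] // s [sP s1] -> b1; apply: xgetPex.
have {s1} s1 : head 1 s != 1 by case: s1 b1 => // ->; rewrite eqxx.
suff [u [c [k [E c1]]]] : exists u c k, s = u ++ c :: nseq k 1 /\ c != 1.
  exists (u, c, k); split=> //; first by rewrite -E.
    by move: s1; rewrite E; case: (u).
  by rewrite -E.
elim/last_ind: s {sP b1} s1 => [|s x IH] /=; first by rewrite eqxx.
have [->|x1 _] := eqVneq x 1; last by exists s, x, 0; rewrite cats1.
case: s IH => [|y s] IH /=; first by rewrite eqxx.
case/IH => u [c [k [E c1]]]; exists u, c, k.+1; split=> //.
by rewrite -rcons_cons E rcons_cat rcons_cons -cats1 -(nseqD k 1) addn1.
Qed.

(** The last conclusion serves the induction: when [p = r >= 2] and the first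
clause of the definition applies with [b_r{t} = 1], the new list would start
with a trivial entry; but then [b_r] is sigma_1, which is [b_r{t}] times
sigma_1, and the first clause does not apply. *)
Lemma sp_op_step n t (b : braid n) : 1 < n -> 0 < t -> special b -> b != 1 ->
  [/\ special (sp_op t b), special_lt (sp_op t b) b
     & sp_op t b = 1 -> b = sigma n 1].
Proof.
move=> + t0; elim: n b => // n IH b _ bP b1; case: (ltnP 1 n) => n1; last first.
  case: n n1 b bP b1 {IH} => [|[|]] // _ b [[|e] ->]; first by rewrite eqxx.
  move=> _; set c := sp_op _ _; have E : sigma 2 1 ^+ e.+1 = c * sigma 2 1.
    apply: (@xgetPex _ _ [set c | sigma 2 1 ^+ e.+1 = c * sigma 2 1]%classic).
    by exists (sigma 2 1 ^+ e); rewrite /= expgSr.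
  (* Right cancellation of sigma_1 is read off the rigid word of its powers. *)
  have {E} cE : c = sigma 2 1 ^+ e.
    have F := presentsM (presents_code c) (@presents_sigma 2 0 isT).
    rewrite -E in F; have {F} := presents_rigid (@presentsX 2 0 e.+1 isT) F
      (loop0_rigid (loop0_nseq _)).
    rewrite cats1 -[e.+1]addn1 nseqD cats1 => F; apply/code_inj.
    by rewrite code_sigma1X; apply/esym/rcons_injl/F.
  split; first by rewrite cE; exists e.
    by rewrite /= cE !code_sigma1X !size_nseq.
  rewrite cE => /(congr1 (@code _)); rewrite code_sigma1X code1.
  by case: e {cE c}.
move: (decomposition_spec n1 bP b1).
have -> : sp_op t b = let: (u, c, k) := decomposition b in
        let c' := sp_op t c in
        if (k == 0) || (c != c' * sigma n 1) then skew (u ++ c' :: nseq k 1)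
        else if (c' != 1) || (u != [::]) then
          skew (u ++ c' :: theta n t :: nseq k.-1 1)
        else skew (theta n t :: nseq k.-1 1).
  by case: n n1 b bP b1 {IH} => [|[|n]].
case: (decomposition b) => -[u c] k [sP u1 c1 bE].
have sN : normal (u ++ c :: nseq k 1).
  by split=> //; right; case: (u) u1.
have [uP cP] : (forall x, x \in u -> special x) /\ special c.
  by split=> [x xu|]; apply: sP; rewrite mem_cat ?xu // mem_head orbT.
have [c'P c'lt c'1] := IH c n1 cP c1; move: (sp_op t c) c'P c'lt c'1 => c' c'P c'lt c'1.
have smaller s : normal s -> s <> [::] ->
    shortlex (@special_lt n) s (u ++ c :: nseq k 1) ->
  [/\ special (skew s), special_lt (skew s) b & skew s = 1 -> b = sigma n.+1 1].
  move=> sN' s0 lt_s; split; first by apply/specialP => //; exists s.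
    by rewrite /= n1 bE !entries_skew.
  by move=> E; have := skew_neq1 n1 sN' s0; rewrite E eqxx.
have [thP th1] := special_theta n1 t0.
have onesP j z : z \in nseq j (1 : braid n) -> special z.
  by rewrite mem_nseq => /andP[_ /eqP ->]; apply: special1.
have normalI v : (u != [::]) || (c' != 1) -> (forall z, z \in v -> special z) ->
    normal (u ++ c' :: v).
  move=> uc vP; split=> [z|].
    by rewrite mem_cat inE => /orP[/uP // | /orP[/eqP -> // | /vP]].
  by right; case: (u) u1 uc.
have notnil v : u ++ c' :: v <> [::] by case: (u).
cbv beta iota zeta; case: ifP => [kc|/negbT/norP[k0 _]].
  have [uc|] := boolP ((u != [::]) || (c' != 1)).
    (* The first entry remains nontrivial. *)
    by apply: smaller => //; [apply: normalI => // z; apply: onesP | apply: shortlex_subst].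
  (* Otherwise [b] is its only nontrivial entry [c], which is sigma_1, followed by
     no trivial one, and the result is [1]. *)
  rewrite negb_or !negbK => /andP[/eqP u0 /eqP c'E].
  rewrite c'E (c'1 c'E) mul1g eqxx orbF in kc; move/eqP: kc => k0.
  have -> : skew (u ++ c' :: nseq k 1) = 1 by rewrite u0 k0 c'E skew1 incl1.
  split; first by apply: special1; apply: ltnW.
    have nilN : normal ([::] : seq (braid n)) by split=> //; left.
    rewrite /= n1 -[1]/(skew ([::] : seq (braid n))) bE !entries_skew // u0.
    by left.
  by move=> _; rewrite bE u0 k0 (c'1 c'E) skew1 incl_sigma1.
case: ifP => uc.
  apply: smaller => //.
    apply: normalI => [|z]; first by rewrite orbC.
    by rewrite inE => /orP[/eqP -> // | /onesP].
  by apply: shortlex_subst => //=; rewrite !size_nseq prednK // lt0n.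
apply: smaller => //.
  split=> [z|]; last by right.
  by rewrite inE => /orP[/eqP -> // | /onesP].
left; rewrite size_cat /= !size_nseq prednK ?lt0n //.
by rewrite ltn_addl.
Qed.

Theorem proposition4p10 (n : nat) (hn : 2 <= n) (b : braid n) :
  special b -> exists t : nat, G_seq b t = 1%g.
Proof.
move=> bP.
suff descend c : forall t, G_seq b t = c -> special c -> exists t, G_seq b t = 1.
  exact: (descend b 0).
elim: {c}(special_lt_wf c) => c _ IH t E cP.
have [c1|c1] := eqVneq c 1; first by exists t; rewrite E.
have [sP slt _] := sp_op_step hn (ltn0Sn t) cP c1.
by apply: (IH _ slt t.+1) => //; rewrite /= E.
Qed.
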